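(* Fix an integer $p\ge2$ and let $\mu$ be a probability measure on $\mathbb R$ having $p$-support with parameters $c,\tilde c,\kappa,A$. Assume $m_1(\mu)=0$ and $m_2(\mu)=1$. Then there exists $t_0=t_0(c,\tilde c,\kappa,A,\boldsymbol m_p(\mu))>0$ such that for any $0\le t\le t_0$ there exists a probability measure $\nu$ coinciding with $\mu$ on $\{|x|>A+1\}$ such that, if $X$ and $G$ are independent random variables, $X$ has distribution $\nu$ and $G$ is a standard Gaussian, then $$X_t:=e^{-t/2}X+(1-e^{-t})^{1/2}G$$ has its first $p$ moments matching exactly those of $\mu$: for all $1\le j\le p$, $m_j(X_t)=m_j(\mu)$.
   Context: For a probability measure $\mu$ on $\mathbb R$, $m_k(\mu)=\int x^k\,d\mu(x)$ and $\boldsymbol m_p(\mu)=(m_1(\mu),\dots,m_p(\mu))\in\mathbb R^p$; moments up to order $p$ are assumed finite. For a real random variable $Y$ with distribution $\mu$, $m_k(Y)$ means $m_k(\mu)$. $p$-support: a probability measure $\mu$ on $\mathbb R$ has $p$-support with parameters $c,\tilde c,\kappa,A$ if $c>\tilde c>0$, $\kappa>0$, $A>0$ and there are $p$ points $x_1,\dots,x_p\in\mathbb R$ such that $\min_{i\ne j}|x_i-x_j|>c$, $\mu[x_i,x_i+\tilde c]>\kappa$ for each $i$, and $\max_i|x_i|\le A$. Two measures coincide on a Borel set $S$ if they assign the same mass to each Borel subset of $S$. *)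

(* Defs.v *)
From mathcomp Require Import all_boot all_order all_algebra.
From mathcomp Require Import all_classical all_reals all_analysis measurable_realfun.

Set Implicit Arguments.
Unset Strict Implicit.
Unset Printing Implicit Defensive.

Import Order.TTheory GRing.Theory Num.Theory.
Import numFieldNormedType.Exports.

Local Open Scope classical_set_scope.
Local Open Scope ring_scope.

Section measures_on_the_line.
Context {R : realType}.
Implicit Types mu nu : probability R R.

(* [Rintegral] is a total function, so [moment] is meaningful only together
   with [finite_moments]. *)
Definition moment mu (k : nat) : R := (\int[mu]_x (x ^+ k))%R.

Definition finite_moments (p : nat) mu : Prop :=
  forall k : nat, (k <= p)%N -> mu.-integrable setT (fun x => (x ^+ k)%:E).

(* Indices are shifted: entry [k] of the row is the moment of order [k + 1]. *)
Definition moments (p : nat) mu : 'rV[R]_p := \row_(k < p) moment mu k.+1.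

Definition p_support (p : nat) (c c' kappa A : R) mu : Prop :=
  [/\ 0 < c' < c, 0 < kappa, 0 < A &
    exists x : 'I_p -> R,
      [/\ forall i j : 'I_p, i != j -> c < `|x i - x j|,
          forall i : 'I_p, (kappa%:E < mu `[x i, (x i + c')%R]%classic)%E &
          forall i : 'I_p, `|x i| <= A]].

Definition coincide_on (S : set R) mu nu : Prop :=
  forall B : set R, measurable B -> B `<=` S -> mu B = nu B.

End measures_on_the_line.

Section random_variables.
Context {R : realType} {d : measure_display} {T : measurableType d}.
Variable P : probability T R.

(* Equality is required on measurable sets only: the value of a measure of the
   library on other sets is arbitrary, so Leibniz equality of [distribution P X]
   with [nu] would be too strong. *)
Definition has_distribution (X : {RV P >-> R})
    (nu : set R -> \bar R) : Prop :=
  forall B : set R, measurable B -> distribution P X B = nu B.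

Definition independent_RV (X Y : {RV P >-> R}) : Prop :=
  forall A B : set R, measurable A -> measurable B ->
    P (X @^-1` A `&` Y @^-1` B) = (P (X @^-1` A) * P (Y @^-1` B))%E.

Definition ou_flow (t : R) (X G : {RV P >-> R}) : {RV P >-> R} :=
  (expR (- t / 2) \o* X \+ Num.sqrt (1 - expR (- t)) \o* G)%R.

End random_variables.

(* Main.v *)
(* The moments of [X_t] determine those of [X] recursively, and the moments prescribed
   for [X] tend to those of [mu] as [t] goes to [0]. So it suffices to perturb the
   moments of order at most [p] of [mu] by any small amounts [delta_j], changing [mu]
   on [|x| <= A + 1] only. As [c' > 1] is allowed, the interval of the rightmost [x_i]
   may leave this region, but the other [n = p - 1] intervals do not. In each of them
   pick a much shorter interval [J_i] of mass bounded below, starting at [y_i], remove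
   a fixed mass from it, and put atoms at the [2 n] nodes [y_i +- h]. Lagrange
   interpolation at the nodes, exact up to degree [2 n - 1], dictates the weights of
   the atoms; for [h] small they are nonnegative with a margin that absorbs the
   [delta_j]. This needs [p <= 2 n - 1], i.e. [p >= 3]. For [p = 2] the normalization
   [m_1 = 0], [m_2 = 1] is invariant under the flow and [nu = mu] works. *)

From HB Require Import structures.
Require Import Defs.
From mathcomp Require Import all_boot all_order all_algebra.
From mathcomp Require Import all_classical all_reals all_analysis.
From mathcomp Require Import measurable_realfun ring lra zify.

Import Order.TTheory GRing.Theory Num.Theory.
Import numFieldNormedType.Exports.

Local Open Scope classical_set_scope.
Local Open Scope ring_scope.

Set Implicit Arguments.
Unset Strict Implicit.

(** * Moments of the standard Gaussian *)

Section gaussian_moments.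
Context {R : realType}.
Notation gamma := (@normal_prob R 0 1).
Notation leb := (@lebesgue_measure R).

Lemma ge0_integral_normal_prob (f : R -> \bar R) :
  measurable_fun setT f -> (forall x, 0 <= f x)%E ->
  (\int[gamma]_x f x = \int[leb]_x (f x * (normal_pdf 0 1 x)%:E))%E.
Proof.
move=> mf f0; have dom := @normal_prob_dominates R 0 1.
rewrite -(Radon_Nikodym_SigmaFinite.change_of_variables dom f0)//.
have intg := Radon_Nikodym_SigmaFinite.f_integrable dom.
have mpdf : measurable_fun setT (fun x => (normal_pdf (0 : R) 1 x)%:E).
  by apply/measurable_EFinP; exact: measurable_normal_pdf.
apply: ae_eq_integral => //.
- by apply: emeasurable_funM => //; exact: measurable_int intg.
- exact: emeasurable_funM.
(* The Radon-Nikodym derivative and the Gaussian density have equal integrals over every measurable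
   set, hence agree almost everywhere. *)
- apply: ae_eqe_mul2l; apply: integral_ae_eq => // E _ mE.
  by rewrite -Radon_Nikodym_SigmaFinite.f_integral.
Qed.

(* The integrand is [s] times the ratio of the densities of [N(a, s^2)] and [N(0, 1)].
   With [1 + u <= expR u] these integrals give the first two Gaussian moments. *)
Lemma integral_gauss_tilt (a s : R) : 0 < s ->
  (\int[gamma]_x (expR (x ^+ 2 / 2 - (x - a) ^+ 2 / (s ^+ 2 *+ 2)))%:E = s%:E)%E.
Proof.
move=> s0; have sn0 : s != 0 by rewrite gt_eqF.
have mtilt : measurable_fun setT
    (fun x : R => expR (x ^+ 2 / 2 - (x - a) ^+ 2 / (s ^+ 2 *+ 2))).
  apply: measurableT_comp => //; apply: measurable_funB;
    apply: measurable_funM => //; apply: measurable_funX => //.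
  exact: measurable_funB.
rewrite ge0_integral_normal_prob; first last.
- by move=> x; rewrite lee_fin expR_ge0.
- exact/measurable_EFinP.
transitivity (\int[leb]_x (s%:E * (normal_pdf a s x)%:E))%E.
  apply: eq_integral => x _; rewrite -!EFinM; congr EFin.
  rewrite !normal_pdfE ?oner_eq0//= mulrCA /normal_fun -expRD.
  rewrite mulrA; congr (_ * expR _); last first.
    by rewrite subr0 expr1n mulNr addrAC subrr add0r mulNr.
  have -> : normal_peak s = s^-1 * normal_peak 1.
    rewrite /normal_peak expr1n mul1r -mulrnAr sqrtrM ?sqr_ge0// sqrtr_sqr.
    by rewrite (ger0_norm (ltW s0)) invfM.
  by rewrite mulrA divff ?mul1r.
rewrite ge0_integralZl//=; last 3 first.
- by apply/measurable_EFinP; exact: measurable_normal_pdf.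
- by move=> x _; rewrite lee_fin normal_pdf_ge0.
- by rewrite lee_fin ltW.
by rewrite integral_normal_pdf mule1.
Qed.

Lemma integrable_gauss_tilt (a s : R) : 0 < s ->
  gamma.-integrable setT
    (fun x => (expR (x ^+ 2 / 2 - (x - a) ^+ 2 / (s ^+ 2 *+ 2)))%:E).
Proof.
move=> s0; apply/integrableP; split.
  apply/measurable_EFinP/measurableT_comp => //; apply: measurable_funB;
    apply: measurable_funM => //; apply: measurable_funX => //.
  exact: measurable_funB.
under eq_integral do rewrite gee0_abs ?lee_fin ?expR_ge0//.
by rewrite integral_gauss_tilt// ltry.
Qed.

(** Powers are dominated by a multiple of [expR (x ^+ 2 / 4)], which is the tilt with [a = 0] and
    [s ^+ 2 = 2]. *)
Lemma integrable_normal_moment (k : nat) :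
  gamma.-integrable setT (fun x => (x ^+ k)%:E).
Proof.
pose s : R := Num.sqrt 2.
have s2 : s ^+ 2 = 2 by rewrite sqr_sqrtr.
have s0 : 0 < s by rewrite sqrtr_gt0.
pose g (x : R) : R := expR (x ^+ 2 / 2 - (x - 0) ^+ 2 / (s ^+ 2 *+ 2)).
have gE x : g x = expR (x ^+ 2 / 4).
  by rewrite /g subr0 s2; congr expR; field.
pose C : R := 1 + 4 ^+ k * (k`!)%:R.
apply: (@le_integrable _ _ _ gamma _ measurableT _ (fun x => (C * g x)%:E)).
- by apply/measurable_EFinP; exact: measurable_funX.
- move=> x _; rewrite !abse_EFin lee_fin gE normrX.
  have g1 : 1 <= expR (x ^+ 2 / 4).
    by rewrite -expR0 ler_expR divr_ge0 ?sqr_ge0.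
  have C0 : 0 <= C by rewrite addr_ge0 ?mulr_ge0 ?exprn_ge0.
  rewrite [leRHS]ger0_norm ?mulr_ge0 ?expR_ge0//.
  (* A single term of the exponential series at [x ^+ 2 / 4] bounds the even power; [expR_ge1Dxn]
     only provides the orders from one on, so [k = 0] is separate. *)
  have x2k : `|x| ^+ k ^+ 2 <= 4 ^+ k * (k`!)%:R * expR (x ^+ 2 / 4).
    rewrite -exprM mulnC exprM -normrX ger0_norm ?sqr_ge0//.
    have kf0 : (0 : R) < (k`!)%:R by rewrite ltr0n fact_gt0.
    case: k {C C0} kf0 => [|k] kf0.
      by rewrite !expr0 fact0 !mul1r.
    have := expR_ge1Dxn k (divr_ge0 (sqr_ge0 x) (ler0n _ 4)).
    rewrite exprMn => h; have {h} : (x ^+ 2) ^+ k.+1 * 4^-1 ^+ k.+1 / k.+1`!%:R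
      <= expR (x ^+ 2 / 4) by rewrite (le_trans _ h)// lerDr.
    rewrite ler_pdivrMr// exprVn ler_pdivrMr ?exprn_gt0// => h.
    by rewrite (le_trans h)// -mulrA mulrC [_ * 4 ^+ _]mulrC.
  have : `|x| ^+ k <= 1 + `|x| ^+ k ^+ 2.
    have := sqr_ge0 (`|x| ^+ k - 1); have : 0 <= `|x| ^+ k by rewrite exprn_ge0.
    set y := `|x| ^+ k; nra.
  move=> /le_trans; apply; rewrite /C [leRHS]mulrDl mul1r lerD//.
- under eq_fun do rewrite EFinM.
  by apply: integrableZl => //; exact: integrable_gauss_tilt.
Qed.

Lemma integrable_normal_poly (k : nat) (a b : R) :
  gamma.-integrable setT (EFin \o (fun x => a + b * x ^+ k)).
Proof.
rewrite (_ : _ \o _ = (EFin \o cst a) \+ (fun x => b%:E * (x ^+ k)%:E))%E//.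
apply: integrableD => //; first exact: finite_measure_integrable_cst.
by apply: integrableZl => //; exact: integrable_normal_moment.
Qed.

Lemma Rintegral_normal_poly (k : nat) (a b : R) :
  \int[gamma]_x (a + b * x ^+ k) = a + b * \int[gamma]_x (x ^+ k).
Proof.
have ik := integrable_normal_moment k.
rewrite RintegralD//; first last.
- exact: (integrableZl measurableT b ik).
- exact: finite_measure_integrable_cst.
rewrite Rintegral_cst// RintegralZl//.
by rewrite [X in fine X]probability_setT mulr1.
Qed.

Lemma Rintegral_normal_le (k : nat) (a b c s : R) : 0 < s ->
  (forall x, a + b * x ^+ k <= x ^+ 2 / 2 - (x - c) ^+ 2 / (s ^+ 2 *+ 2)) ->
  1 + a + b * \int[gamma]_x (x ^+ k) <= s.
Proof.
move=> s0 h; rewrite -Rintegral_normal_poly.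
rewrite -[leRHS](_ : \int[gamma]_x
  expR (x ^+ 2 / 2 - (x - c) ^+ 2 / (s ^+ 2 *+ 2)) = s); last first.
  by rewrite /Rintegral integral_gauss_tilt.
apply: le_Rintegral => //.
- exact: integrable_normal_poly.
- exact: integrable_gauss_tilt.
- by move=> x _; rewrite -addrA (le_trans _ (expR_ge1Dx _))// lerD2l.
Qed.

Lemma Rintegral_normal0 : \int[gamma]_x (x ^+ 0) = 1.
Proof.
rewrite -[LHS](_ : \int[gamma]_(x in setT) 1 = _); last exact: eq_Rintegral.
by rewrite Rintegral_cst// mul1r [X in fine X]probability_setT.
Qed.

(** For [s = 1] the exponent of the tilt is [a * x - a ^+ 2 / 2], so the mean [E] satisfies
    [a * E <= a ^+ 2 / 2] for every [a]; the choice [a = E] forces [E = 0]. *)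
Lemma Rintegral_normal1 : \int[gamma]_x (x ^+ 1) = 0.
Proof.
have key (a : R) : a * \int[gamma]_x (x ^+ 1) <= a ^+ 2 / 2.
  have := @Rintegral_normal_le 1 (- (a ^+ 2 / 2)) a a 1 ltr01.
  set E := Rintegral _ _ _ => h; suff : 1 - a ^+ 2 / 2 + a * E <= 1 by lra.
  by apply: h => x; rewrite le_eqVlt; apply/orP; left; apply/eqP; field.
apply/eqP; rewrite eq_le; apply/andP; split; rewrite leNgt; apply/negP => h;
  have := key (\int[gamma]_x (x ^+ 1)); nra.
Qed.

(** Centred tilts bound [E] from above when [s > 1] and from below when [s < 1]; both bounds tend to
    1 as [s] does. *)
Lemma Rintegral_normal2 : \int[gamma]_x (x ^+ 2) = 1.
Proof.
set E := Rintegral _ _ _.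
have key (s : R) : 0 < s -> (s ^+ 2 - 1) * E <= 2 * (s - 1) * s ^+ 2.
  move=> s0; have := @Rintegral_normal_le 2 0 ((1 - (s ^+ 2)^-1) / 2) 0 s s0.
  rewrite -/E => h; have : 1 + 0 + (1 - (s ^+ 2)^-1) / 2 * E <= s.
    apply: h => x; rewrite le_eqVlt; apply/orP; left; apply/eqP; field.
    by rewrite gt_eqF.
  have s20 : 0 < s ^+ 2 by rewrite exprn_gt0.
  rewrite -(ler_pM2r s20) => {}h.
  suff -> : (s ^+ 2 - 1) * E = 2 * ((1 + 0 + (1 - (s ^+ 2)^-1) / 2 * E) * s ^+ 2)
      - 2 * s ^+ 2 by lra.
  by field; rewrite gt_eqF.
(* [s = 1 + e], then division by [e]; [s = 1 - e] gives the reverse bound [dn]. *)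
have up (e : R) : 0 < e -> E <= 1 + e *+ 2.
  move=> e0; have /key h : 0 < 1 + e by lra.
  have {}h : e * ((2 + e) * E) <= e * (2 * (1 + e) ^+ 2) by lra.
  by move: h; rewrite ler_pM2l//; nra.
have dn (e : R) : 0 < e < 1 -> 1 - e *+ 2 <= E.
  move=> /andP[e0 e1]; have /key h : 0 < 1 - e by lra.
  have {}h : e * (2 * (1 - e) ^+ 2) <= e * ((2 - e) * E) by lra.
  by move: h; rewrite ler_pM2l//; nra.
(* If [E] differed from 1, taking [e] to be a quarter of the gap would give a gap at most half of
   itself. [E0] keeps this [e] below 1. *)
apply/eqP; rewrite eq_le; apply/andP; split; rewrite leNgt; apply/negP => h.
  have /up : 0 < (E - 1) / 4 by lra.
  lra.
have E0 : 0 <= E by apply: Rintegral_ge0 => x _; exact: sqr_ge0.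
have /dn : 0 < (1 - E) / 4 < 1 by apply/andP; split; lra.
lra.
Qed.

End gaussian_moments.

(** * Independence and the moments of the flow *)

Section independence.
Context {R : realType}.

(** The laws are compared on measurable sets only, as in [has_distribution]; this already fixes the
    integrals against the pushforward of [P]. *)
Lemma Rintegral_transfer d1 d2 (T : measurableType d1) (U : measurableType d2)
    (P : {measure set T -> \bar R}) (nu : {measure set U -> \bar R})
    (phi : T -> U) (f : U -> R) :
  measurable_fun setT phi ->
  (forall B, measurable B -> P (phi @^-1` B) = nu B) ->
  nu.-integrable setT (EFin \o f) ->
  P.-integrable setT (EFin \o (f \o phi)) /\
  \int[P]_w (f (phi w)) = \int[nu]_x (f x).
Proof.
move=> mphi law intf.
have mf : measurable_fun setT f by apply/measurable_EFinP; exact: measurable_int intf.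
have eqm (h : U -> \bar R) :
    (\int[pushforward P phi]_x h x = \int[nu]_x h x)%E.
  by apply: eq_measure_integral => B mB _; exact: law.
have intP : P.-integrable setT (EFin \o (f \o phi)).
  apply/integrableP; split.
    by apply/measurable_EFinP; exact: measurableT_comp.
  have /integrableP[_] := intf; rewrite -eqm ge0_integral_pushforward//.
  exact/measurableT_comp/measurable_EFinP.
split=> //; rewrite /Rintegral -eqm integral_pushforward//.
exact/measurable_EFinP.
Qed.

Lemma Rintegral_prodM d1 d2 (T : measurableType d1) (U : measurableType d2)
    (m1 : probability T R) (m2 : probability U R) (f : T -> R) (g : U -> R) :
  m1.-integrable setT (EFin \o f) -> m2.-integrable setT (EFin \o g) ->
  (m1 \x m2)%E.-integrable setT (EFin \o (fun z => f z.1 * g z.2)) /\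
  \int[(m1 \x m2)%E]_z (f z.1 * g z.2) = \int[m1]_x f x * \int[m2]_y g y.
Proof.
move=> intf intg.
have mf : measurable_fun setT f by apply/measurable_EFinP; exact: measurable_int intf.
have mg : measurable_fun setT g by apply/measurable_EFinP; exact: measurable_int intg.
have mfg : measurable_fun setT (fun z : T * U => (f z.1 * g z.2)%:E).
  by apply/measurable_EFinP; apply: measurable_funM; exact: measurableT_comp.
have intfg : (m1 \x m2)%E.-integrable setT (EFin \o (fun z => f z.1 * g z.2)).
  apply/integrable12ltyP => //.
  rewrite [X in (integral _ _ X < _)%E](_ : _ = fun x => \int[m2]_y `|(f x * g y)%:E|)%E//.
  have -> : (fun x => \int[m2]_y `|(f x * g y)%:E|)%E =
      (fun x => (`|f x|%:E) * \int[m2]_y `|(EFin \o g) y|)%E.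
    apply/funext => x; rewrite -ge0_integralZl//.
      by apply: eq_integral => y _; rewrite /= -EFinM normrM.
    by apply: measurableT_comp => //; exact/measurable_EFinP.
  rewrite ge0_integralZr//.
  - by rewrite lte_mul_pinfty ?integral_ge0//; [
      rewrite ge0_fin_numE ?integral_ge0//; case/integrableP: intf|
      case/integrableP: intg].
  - by apply/measurable_EFinP; exact: measurableT_comp.
  - exact: integral_ge0.
split=> //; rewrite /Rintegral -integral12_prod_meas1//= /fubini_F.
rewrite -[RHS]RintegralZr//; congr fine; apply: eq_integral => x _.
rewrite EFinM fineK; last exact: integrable_fin_num.
by rewrite -integralZl.
Qed.

Lemma Rintegral_sum d (T : measurableType d) (P : {measure set T -> \bar R})
    (D : set T) (I : Type) (s : seq I) (f : I -> T -> R) :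
  measurable D -> (forall i, P.-integrable D (EFin \o f i)) ->
  P.-integrable D (EFin \o (fun x => \sum_(i <- s) f i x)) /\
  \int[P]_(x in D) (\sum_(i <- s) f i x) = \sum_(i <- s) \int[P]_(x in D) f i x.
Proof.
move=> mD intf; elim: s => [|i s [IH1 IH2]].
  have -> : (fun x => \sum_(i <- [::]) f i x) = cst 0.
    by apply/funext => x; rewrite big_nil.
  by rewrite Rintegral_cst// mul0r big_nil; split=> //; exact: integrable0.
have -> : (fun x => \sum_(j <- i :: s) f j x) =
    fun x => f i x + \sum_(j <- s) f j x.
  by apply/funext => x; rewrite big_cons.
rewrite big_cons RintegralD// IH2; split=> //.
exact: (integrableD mD (intf i) IH1).
Qed.

Lemma moment0 (mu : probability R R) : moment mu 0 = 1.
Proof.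
rewrite /moment -[LHS](_ : \int[mu]_(x in setT) 1 = _); last exact: eq_Rintegral.
by rewrite Rintegral_cst// mul1r [X in fine X]probability_setT.
Qed.

(** The joint law of [(X, G)] is the product of the marginals, since they agree on rectangles;
    Fubini then factors the mixed moment. *)
Lemma independent_prod_moment d (T : measurableType d) (P : probability T R)
    (X G : {RV P >-> R}) (nu : probability R R) (i k : nat) :
  independent_RV X G -> has_distribution X nu ->
  has_distribution G (normal_prob 0 1) ->
  nu.-integrable setT (fun x => (x ^+ i)%:E) ->
  P.-integrable setT (EFin \o (fun w => X w ^+ i * G w ^+ k)) /\
  \int[P]_w (X w ^+ i * G w ^+ k) =
    moment nu i * \int[normal_prob 0 1]_y (y ^+ k).
Proof.
move=> indep lawX lawG inti.
have [int12 E12] := Rintegral_prodM inti (integrable_normal_moment k).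
pose phi (w : T) : R * measurableTypeR R := (X w, G w).
have mphi : measurable_fun setT phi.
  apply/measurable_fun_pair => //.
  have : measurable_fun setT (G : T -> R) by [].
  by move=> mG mT' Y mY; exact: mG.
rewrite /moment -E12.
apply: (Rintegral_transfer mphi _ int12) => B mB.
apply/esym; apply: (product_measure_unique (m' := pushforward P phi)) => // C D mC mD.
rewrite /pushforward.
transitivity (P (X @^-1` C `&` G @^-1` D)); first by [].
by rewrite indep//; congr (_ * _)%E; [exact: lawX|exact: lawG].
Qed.

(** Binomial expansion of the power, each mixed moment factoring by independence; [i] counts the
    Gaussian factors. *)
Lemma moment_ou_flow d (T : measurableType d) (P : probability T R)
    (X G : {RV P >-> R}) (nu : probability R R) (p : nat) (t : R) :
  independent_RV X G -> has_distribution X nu ->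
  has_distribution G (normal_prob 0 1) -> finite_moments p nu ->
  finite_moments p (distribution P (ou_flow t X G)) /\
  forall j, (j <= p)%N ->
    moment (distribution P (ou_flow t X G)) j =
    \sum_(i < j.+1) ((Num.sqrt (1 - expR (- t)) : R) ^+ i *
      (\int[normal_prob 0 1]_y (y ^+ i))) *
      (expR (- t / 2) ^+ (j - i) * moment nu (j - i)) *+ 'C(j, i).
Proof.
move=> indep lawX lawG intnu.
set a := expR (- t / 2); set b := Num.sqrt _.
pose f j (i : 'I_j.+1) w : R :=
  ((a ^+ (j - i) * b ^+ i) *+ 'C(j, i)) * (X w ^+ (j - i) * G w ^+ i).
have ouX j w : ou_flow t X G w ^+ j = \sum_(i < j.+1) f j i w.
  rewrite [ou_flow _ _ _ _](_ : _ = a * X w + b * G w); last first.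
    by rewrite /ou_flow /= mulrC [G w * _]mulrC.
  rewrite exprDn; apply: eq_bigr => i _.
  by rewrite !exprMn /f mulrnAl mulrACA.
have Ej : forall j (i : 'I_j.+1), (j <= p)%N ->
    P.-integrable setT (EFin \o f j i) /\
    \int[P]_w f j i w = ((a ^+ (j - i) * b ^+ i) *+ 'C(j, i)) *
      (moment nu (j - i) * \int[normal_prob 0 1]_y (y ^+ i)).
  move=> j i jp; have jip : (j - i <= p)%N by rewrite (leq_trans (leq_subr _ _)).
  have [int E] := independent_prod_moment i indep lawX lawG (intnu _ jip).
  rewrite /f RintegralZl// E; split=> //.
  exact: (integrableZl measurableT _ int).
have intou j : (j <= p)%N ->
    P.-integrable setT (EFin \o (fun w => ou_flow t X G w ^+ j)).
  move=> jp; have [int _] := Rintegral_sum (enum 'I_j.+1) measurableT (fun i => (Ej j i jp).1).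
  rewrite [_ \o _](_ : _ = EFin \o (fun x => \sum_(i <- enum 'I_j.+1) f j i x))//.
  by apply/funext => w /=; rewrite ouX big_enum.
have mX (j : nat) : measurable_fun setT (fun x : R => (x ^+ j)%:E).
  by apply/measurable_EFinP; exact: measurable_funX.
split=> [k kp|j jp].
  apply: integrable_pushforward => //; exact: intou.
rewrite {1}/moment {1}/Rintegral integral_pushforward//; last exact: intou.
rewrite -/(Rintegral P setT (fun w => ou_flow t X G w ^+ j)).
under eq_Rintegral do rewrite ouX -big_enum.
have [_ ->] := Rintegral_sum (enum 'I_j.+1) measurableT (fun i => (Ej j i jp).1).
rewrite big_enum; apply: eq_bigr => i _; rewrite (Ej j i jp).2.
by rewrite mulrnAl; congr (_ *+ _); ring.
Qed.

End independence.

(** * Changing moments by cutting mass and adding atoms *)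

Section probability_of_measure.
Context {R : realType} d (T : measurableType d) (nu : {measure set T -> \bar R}).
Hypothesis nuT : nu setT = 1%E.

(** An alias of [nu] that carries the proof of total mass one as an argument, so that the
    probability instance can be attached to it. *)
Definition probability_of_measure of nu setT = 1%E := (nu : set T -> \bar R).

HB.instance Definition _ := Measure.on (probability_of_measure nuT).
HB.instance Definition _ :=
  Measure_isProbability.Build _ _ _ (probability_of_measure nuT) nuT.

End probability_of_measure.

Section moment_surgery.
Context {R : realType}.

(** The measure is specified by its nonnegative integrals, so that restrictions and atoms can be
    mixed and used without unfolding the construction. *)
Lemma weighted_sum_measure d (T : measurableType d) (I : Type) (s : seq I)
    (a : I -> R) (m : I -> {measure set T -> \bar R}) :
  (forall i, 0 <= a i) ->
  exists nu : {measure set T -> \bar R},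
    forall g : T -> \bar R, measurable_fun setT g -> (forall x, 0 <= g x)%E ->
      (\int[nu]_x g x = \sum_(i <- s) (a i)%:E * \int[m i]_x g x)%E.
Proof.
move=> a0; elim: s => [|i s [nu nuI]].
  exists mzero => g mg g0.
  by rewrite big_nil integral_measure_zero.
pose ai : {nonneg R} := NngNum (a0 i).
exists (measure_add (mscale ai (m i)) nu) => g mg g0.
by rewrite ge0_integral_measure_add// ge0_integral_mscale// nuI// big_cons.
Qed.

(** The formula passes from nonnegative to integrable functions through positive and negative parts,
    all of whose integrals are finite. *)
Lemma Rintegral_weighted_sum d (T : measurableType d) (I : Type) (s : seq I)
    (a : I -> R) (m : I -> {measure set T -> \bar R})
    (nu : {measure set T -> \bar R}) (f : T -> R) :
  (forall g : T -> \bar R, measurable_fun setT g -> (forall x, 0 <= g x)%E ->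
    (\int[nu]_x g x = \sum_(i <- s) (a i)%:E * \int[m i]_x g x)%E) ->
  measurable_fun setT f -> (forall i, (m i).-integrable setT (EFin \o f)) ->
  nu.-integrable setT (EFin \o f) /\
  \int[nu]_x f x = \sum_(i <- s) a i * \int[m i]_x f x.
Proof.
move=> nuI mf intf.
have mEf : measurable_fun setT (EFin \o f) by exact/measurable_EFinP.
have nuE (g : T -> \bar R) : measurable_fun setT g -> (forall x, 0 <= g x)%E ->
    (forall i, \int[m i]_x g x \is a fin_num)%E ->
    (\int[nu]_x g x = (\sum_(i <- s) a i * fine (\int[m i]_x g x))%:E)%E.
  move=> mg g0 fin; rewrite nuI// -sumEFin; apply: eq_bigr => i _.
  by rewrite EFinM fineK.
have finp i : (\int[m i]_x ((EFin \o f)^\+)%E x)%E \is a fin_num.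
  exact/integrable_fin_num/integrable_funepos.
have finn i : (\int[m i]_x ((EFin \o f)^\-)%E x)%E \is a fin_num.
  exact/integrable_fin_num/integrable_funeneg.
split.
  apply/integrableP; split=> //; rewrite nuE ?ltry//.
    exact: measurableT_comp.
  move=> i; rewrite ge0_fin_numE ?integral_ge0//.
  by case/integrableP: (intf i).
have mfp := measurable_funepos mEf; have mfn := measurable_funeneg mEf.
rewrite /Rintegral integralE !nuE//.
rewrite -EFinB -sumrB; apply: eq_bigr => i _.
by rewrite -mulrBr -fineB// -integralE.
Qed.

Lemma integral_mrestr d (T : measurableType d) (mu : {measure set T -> \bar R})
    (D : set T) (mD : measurable D) (f : T -> R) :
  mu.-integrable D (EFin \o f) -> measurable_fun setT f ->
  (mrestr mu mD).-integrable setT (EFin \o f) /\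
  \int[mrestr mu mD]_x f x = \int[mu]_(x in D) f x.
Proof.
move=> intf mf.
have nul : mrestr mu mD (~` D) = 0%E by rewrite /mrestr setICl measure0.
have mDc : measurable (~` D) by exact: measurableC.
have eqm (g : T -> \bar R) :
    (\int[mrestr mu mD]_(x in D) g x = \int[mu]_(x in D) g x)%E.
  apply: eq_measure_integral => A mA AD.
  by transitivity (mu (A `&` D)) => //; rewrite setIidl.
have int : (mrestr mu mD).-integrable setT (EFin \o f).
  apply/integrableP; split; first exact/measurable_EFinP.
  rewrite (@ge0_negligible_integral _ _ _ _ _ (~` D))//; last first.
    exact/measurableT_comp/measurable_EFinP.
  by rewrite setTD setCK eqm; case/integrableP: intf.
split=> //; rewrite /Rintegral (@negligible_integral _ _ _ _ _ (~` D))//.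
by rewrite setTD setCK eqm.
Qed.

Lemma integral_dirac_real d (T : measurableType d) (z : T) (f : T -> R) :
  measurable_fun setT f ->
  (\d_z : {measure set T -> \bar R}).-integrable setT (EFin \o f) /\
  \int[\d_z]_x f x = f z.
Proof.
move=> mf; have mEf : measurable_fun setT (EFin \o f) by exact/measurable_EFinP.
split.
  apply/integrableP; split=> //; rewrite integral_dirac//.
    by rewrite diracT mul1e /= ltry.
  exact: measurableT_comp.
by rewrite /Rintegral integral_dirac// diracT mul1e.
Qed.

(* Writing [mu] as [n] copies of [mu / n] and cutting each [J i] out of its own copy
   avoids having to assume the [J i] disjoint. *)
Lemma cut_and_add_atoms (mu : probability R R) (n : nat) (J : 'I_n -> set R)
    (a : 'I_n -> R) (K : finType) (z : K -> R) (w : K -> R) :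
  (0 < n)%N -> (forall i, measurable (J i)) ->
  (forall i, 0 <= a i <= n%:R^-1) -> (forall k, 0 <= w k) ->
  exists nu : {measure set R -> \bar R}, forall f : R -> R,
    mu.-integrable setT (EFin \o f) ->
    nu.-integrable setT (EFin \o f) /\
    \int[nu]_x f x = \int[mu]_x f x - \sum_(i < n) a i * \int[mu]_(x in J i) f x
      + \sum_k w k * f (z k).
Proof.
move=> n0 mJ a01 w0.
(* [(i, true)] indexes [J i] with weight [n^-1 - a i], [(i, false)] its complement with weight
   [n^-1], and [inr k] an atom. *)
pose D (v : 'I_n * bool) := if v.2 then J v.1 else ~` J v.1.
have mD v : measurable (D v) by rewrite /D; case: v.2 => //; exact: measurableC.
pose c (u : 'I_n * bool + K) : R := match u with
  | inl v => n%:R^-1 - (if v.2 then a v.1 else 0) | inr k => w k end.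
pose m (u : 'I_n * bool + K) : {measure set R -> \bar R} := match u with
  | inl v => mrestr mu (mD v)
  | inr k => \d_(z k) end.
have c0 u : 0 <= c u.
  case: u => [[i [|]]|k] /=; last exact: w0.
    by have := a01 i; rewrite subr_ge0 => /andP[].
  by rewrite subr0 invr_ge0.
have [nu nuI] := weighted_sum_measure (index_enum _) m c0.
exists nu => f intf.
have mf : measurable_fun setT f by apply/measurable_EFinP; exact: measurable_int intf.
have intD v : mu.-integrable (D v) (EFin \o f) by exact: integrableS intf.
have intm u : (m u).-integrable setT (EFin \o f).
  case: u => [v|k] /=; first exact: (integral_mrestr (mD v) (intD v) mf).1.
  exact: (integral_dirac_real (z k) mf).1.
have [? ->] := Rintegral_weighted_sum nuI mf intm; split=> //.
rewrite big_sumType/=; congr (_ + _); last first.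
  by apply: eq_bigr => k _; rewrite (integral_dirac_real (z k) mf).2.
under eq_bigr => v _ do rewrite (integral_mrestr (mD v) (intD v) mf).2.
rewrite -(pair_bigA _ (fun i b => (n%:R^-1 - (if b then a i else 0)) *
  \int[mu]_(x in D (i, b)) f x))/=.
transitivity (\sum_(i < n) (n%:R^-1 * \int[mu]_x f x - a i * \int[mu]_(x in J i) f x)).
  apply: eq_bigr => i _; rewrite big_bool/=.
  rewrite -[in X in _ = _ * X - _](setUv (J i)) Rintegral_setU ?setUv//; last 2 first.
  - exact: measurableC.
  - by apply/disj_setPS; rewrite setICr.
  by rewrite subr0 mulrBl mulrDr addrAC.
rewrite sumrB sumr_const card_ord -[X in X - _]mulr_natr mulrAC mulVf ?mul1r//.
by rewrite pnatr_eq0 -lt0n.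
Qed.

(** The weight of the atom at [z k] is the value at [q k] of the linear functional sending ['X^m] to
    the removed moment of order [m] plus [delta m]. By the interpolation hypothesis the atoms
    reproduce this functional up to degree [p]: they restore what was cut and add [delta]. *)
Lemma moment_surgery (mu : probability R R) (n p : nat) (J : 'I_n -> set R)
    (a : 'I_n -> R) (K : finType) (z : K -> R) (q : K -> {poly R})
    (delta : nat -> R) :
  (0 < n)%N -> finite_moments p mu -> (forall i, measurable (J i)) ->
  (forall i k, mu.-integrable (J i) (fun x => (q k).[x]%:E)) ->
  (forall i, 0 <= a i <= n%:R^-1) ->
  (forall j, (j <= p)%N -> \sum_k z k ^+ j *: q k = 'X^j) ->
  (forall k, 0 <= \sum_(i < n) a i * \int[mu]_(x in J i) (q k).[x]
    + \sum_(m < p.+1) (q k)`_m * delta m) ->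
  delta 0%N = 0 ->
  exists nu : probability R R, [/\
    forall S, measurable S -> (forall i, S `&` J i = set0) ->
      (forall k, ~ S (z k)) -> nu S = mu S,
    finite_moments p nu &
    forall j, (j <= p)%N -> moment nu j = moment mu j + delta j].
Proof.
move=> n0 intmu mJ intq a01 interp w0 d0.
have [nu nuI] := cut_and_add_atoms mu z n0 mJ a01 w0.
have nuM j : (j <= p)%N -> nu.-integrable setT (EFin \o (fun x => x ^+ j)) /\
    \int[nu]_x (x ^+ j) = moment mu j + delta j.
  move=> jp; have [? ->] := nuI _ (intmu j jp); split=> //.
  rewrite -addrA; congr (_ + _); apply/eqP; rewrite addrC subr_eq; apply/eqP.
  under eq_bigr do rewrite mulrDl.
  rewrite big_split/= addrC; congr (_ + _).
    (* Contribution of [delta]: comparing coefficients of order [m] in the interpolation identity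
       leaves only [m = j]. *)
    under eq_bigr do rewrite mulr_suml.
    rewrite exchange_big/= (bigD1 (inord j))//= inordK// -[RHS]addr0.
    have coefI (m : nat) : \sum_k (q k)`_m * delta m * z k ^+ j = (m == j)%:R * delta m.
      rewrite -coefXn -(interp j jp) coef_sum mulr_suml.
      by apply: eq_bigr => k _; rewrite coefZ mulrC mulrA.
    rewrite coefI eqxx mul1r; congr (_ + _); apply: big1 => m.
    rewrite coefI -val_eqE/= inordK// => /negbTE ->; exact: mul0r.
  (* Contribution of the cut mass: the interpolation identity is evaluated pointwise and integrated
     over [J i]. *)
  under eq_bigr do rewrite mulr_suml.
  rewrite exchange_big/=; apply: eq_bigr => i _.
  under eq_bigr do rewrite -mulrA.
  rewrite -mulr_sumr; congr (_ * _).
  have intzq k : mu.-integrable (J i) (EFin \o (fun x => z k ^+ j * (q k).[x])).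
    exact: (integrableZl (mJ i) _ (intq i k)).
  have [_ intsum] := Rintegral_sum (index_enum K) (mJ i) intzq.
  transitivity (\sum_k \int[mu]_(x in J i) (z k ^+ j * (q k).[x])).
    by apply: eq_bigr => k _; rewrite RintegralZl// 1?mulrC//; exact: intq.
  rewrite -intsum; apply: eq_Rintegral => x _.
  rewrite -[RHS]hornerXn -(interp j jp) horner_sum.
  by apply: eq_bigr => k _; rewrite hornerZ.
(* Order zero with [delta 0 = 0] gives total mass one. As [fine] forgets infinite values, finiteness
   is taken from [int0]. *)
have nuT : nu setT = 1%E.
  have [int0] := nuM 0%N isT; rewrite d0 addr0 /moment.
  rewrite -[LHS](_ : \int[nu]_(x in setT) 1 = _); last by apply: eq_Rintegral.
  rewrite -[RHS](_ : \int[mu]_(x in setT) 1 = _); last by apply: eq_Rintegral.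
  rewrite !Rintegral_cst// !mul1r [X in _ = fine X -> _](_ : _ = 1%E); last first.
    exact: probability_setT.
  move=> nu1; rewrite -[RHS]/((fine 1%E)%:E) -nu1.
  rewrite fineK// ge0_fin_numE//; case/integrableP: int0 => _.
  by rewrite (eq_integral (cst 1%E)) ?integral_cst ?mul1e// => x _; rewrite /= normr1.
pose nuP : probability R R := probability_of_measure nuT.
exists nuP; split=> [S mS SJ Sz|k kp|j jp].
(* Masses are recovered by testing on the indicator of [S], to which neither the cut pieces nor the
   atoms contribute. *)
- have intS (m : probability R R) : m.-integrable setT (EFin \o \1_S).
    exact: integrable_indic.
  have ES (m : probability R R) (D : set R) : measurable D ->
      \int[m]_(x in D) \1_S x = fine (m (S `&` D)).
    by move=> mD; rewrite /Rintegral integral_indic.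
  have [_ eqS] := nuI _ (intS mu).
  have fin (m : probability R R) : m S \is a fin_num.
    by rewrite ge0_fin_numE// (le_lt_trans (probability_le1 m mS))// ltry.
  rewrite -(fineK (fin nuP)) -(fineK (fin mu)) -[S in LHS]setIT -[S in RHS]setIT.
  rewrite -!ES// [X in X%:E = _]eqS.
  rewrite big1 ?big1 ?subr0 ?addr0// => [k|i] _.
    by rewrite indicE memNset ?mulr0.
  by rewrite ES// SJ measure0 mulr0.
- exact: (nuM k kp).1.
- exact: (nuM j jp).2.
Qed.

End moment_surgery.

(** * Lagrange interpolation and bounds on its basis polynomials *)

Section lagrange.
Context {F : fieldType} (K : finType) (z : K -> F).

Definition lagrange_basis (k : K) : {poly F} :=
  \prod_(l | l != k) ((z k - z l)^-1 *: ('X - (z l)%:P)).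

Lemma horner_lagrange (k : K) (x : F) :
  (lagrange_basis k).[x] = \prod_(l | l != k) ((x - z l) / (z k - z l)).
Proof.
by rewrite horner_prod; apply: eq_bigr => l _; rewrite !hornerE mulrC.
Qed.

Lemma size_lagrange (k : K) : (size (lagrange_basis k) <= #|K|)%N.
Proof.
apply: leq_trans (size_prod_leq _ _) _.
have cK : #|[pred l | l != k]| = #|K|.-1 by rewrite cardC1.
have K0 : (0 < #|K|)%N by apply/card_gt0P; exists k.
have : (\sum_(l | l != k) size ((z k - z l)^-1 *: ('X - (z l)%:P)) <= #|K|.-1 * 2)%N.
  rewrite -cK -sum_nat_const; apply: leq_sum => l _.
  by rewrite (leq_trans (size_scale_leq _ _))// size_XsubC.
rewrite cK leq_subLR => /leq_ltn_trans; apply; lia.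
Qed.

(** The difference of the two sides has degree below the number of nodes and vanishes at all of
    them. *)
Lemma lagrange_interpolation (j : nat) : injective z -> (j < #|K|)%N ->
  \sum_k z k ^+ j *: lagrange_basis k = 'X^j.
Proof.
move=> injz jK; apply/eqP; rewrite -subr_eq0; set r := _ - _.
have Lz k l : (lagrange_basis k).[z l] = (k == l)%:R.
  rewrite horner_lagrange; have [<-|kl] := eqVneq k l.
    by apply: big1 => i ik; rewrite divff// subr_eq0 (inj_eq injz) eq_sym.
  by rewrite (bigD1 l) 1?eq_sym//= subrr !mul0r.
apply/eqP/(@roots_geq_poly_eq0 _ r [seq z k | k <- enum K]).
- apply/allP => _ /mapP[l _ ->]; rewrite rootE /r !hornerE horner_sum.
  rewrite (bigD1 l)//= hornerZ Lz eqxx mulr1 big1 ?addr0 ?subrr// => k /negbTE kl.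
  by rewrite hornerZ Lz kl mulr0.
- by rewrite map_inj_uniq ?enum_uniq.
- rewrite size_map -cardE (leq_trans (size_polyD _ _))// size_polyN size_polyXn.
  rewrite geq_max jK andbT (leq_trans (size_sum _ _ _))//.
  apply/bigmax_leqP => k _.
  by rewrite (leq_trans (size_scale_leq _ _))// size_lagrange.
Qed.

End lagrange.

Section lagrange_bounds.
Context {R : realFieldType}.

(** Each linear factor replaces a coefficient by a combination of two consecutive ones, which
    multiplies the uniform bound by at most [(1 + B) / s]. *)
Lemma coef_lagrange_le (K : finType) (z : K -> R) (B s : R) (k : K) (m : nat) :
  0 < s -> (forall l, `|z l| <= B) -> (forall l, l != k -> s <= `|z k - z l|) ->
  `|(lagrange_basis z k)`_m| <= ((1 + B) / s) ^+ #|K|.-1.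
Proof.
move=> s0 zB sz; rewrite -(cardC1 k) -[#|_|](@eq_card _ [pred l | l != k])//.
rewrite -prodr_const /lagrange_basis; move: m.
have B0 : 0 <= B by apply: le_trans (zB k).
apply: (big_rec2 (fun (p : {poly R}) c => forall m, `|p`_m| <= c)) => [m|].
  by rewrite coef1; case: (m == 0%N) => /=; rewrite ?normr1 ?normr0.
move=> l p c lk ihp m; have c0 : 0 <= c by apply: le_trans (ihp 0%N).
rewrite -scalerAl coefZ normrM normfV mulrC [leRHS]mulrAC.
have zkl : 0 < `|z k - z l| by apply: lt_le_trans (sz l lk).
apply: ler_pM => //.
  rewrite mulrBl coefB coefXM mul_polyC coefZ.
  rewrite (le_trans (ler_normB _ _))// mulrDl mul1r lerD//.
    by case: m => [|m] /=; rewrite ?normr0// ihp.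
  by rewrite normrM ler_pM.
by rewrite lef_pV2// sz.
Qed.

Lemma bernoulli_le (u : R) (n : nat) : 0 <= u <= 1 -> 1 - n%:R * u <= (1 - u) ^+ n.
Proof.
move=> /andP[u0 u1]; elim: n => [|n IH]; first by rewrite expr0 mul0r subr0.
have := exprn_ge0 n u0; rewrite exprS -natr1.
have : (0 : R) <= n%:R by []. 
move: IH; set y := (_ ^+ n); set v := n%:R => IH v0 _.
have : 0 <= (1 - u) * (y - (1 - v * u)) by rewrite mulr_ge0// subr_ge0.
have : 0 <= v * u * u by rewrite !mulr_ge0.
nra.
Qed.

End lagrange_bounds.
(* Doubling each [y i] into [y i +- h] yields [2 n] interpolation nodes. On a point
   within [h / 2] of [y i], the two Lagrange polynomials of the pair of [i] are
   bounded below by [1 / 8], and all the others are [O(h)]. *)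
Section paired_nodes.
Context {R : realFieldType} (n : nat) (y : 'I_n -> R) (A s h : R).
Hypotheses (yA : forall i, `|y i| <= A)
  (ys : forall i j, i != j -> s <= `|y i - y j|)
  (h0 : 0 < h) (h1 : h <= 2^-1) (hs : 12 * n%:R * h <= s).

Definition paired_node (u : 'I_n * bool) : R := y u.1 + (if u.2 then h else - h).

Lemma paired_nodeB (u : 'I_n * bool) : `|paired_node u - y u.1| = h.
Proof.
by rewrite /paired_node addrC addKr; case: u.2; rewrite ?normrN gtr0_norm.
Qed.

Lemma paired_node_le (u : 'I_n * bool) : `|paired_node u| <= A + 2^-1.
Proof.
have h1' := h1.
have := paired_nodeB u; have := yA u.1.
have := ler_normD (paired_node u - y u.1) (y u.1); rewrite subrK; lra.
Qed.

Lemma separation_ge (i : 'I_n) : 12 * h <= s.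
Proof.
have n1 : (1 : R) <= n%:R by rewrite ler1n (leq_ltn_trans _ (ltn_ord i)).
apply: le_trans hs; rewrite ler_pM2r// ler_peMr//.
Qed.

Lemma paired_node_far (u v : 'I_n * bool) :
  u.1 != v.1 -> s / 2 <= `|paired_node u - paired_node v|.
Proof.
have h0' := h0.
move=> uv; have := ys uv; have := paired_nodeB u; have := paired_nodeB v.
have := separation_ge u.1.
have := ler_distD (paired_node u) (y u.1) (y v.1).
have := ler_distD (paired_node v) (paired_node u) (y v.1).
rewrite [`|y u.1 - paired_node u|]distrC; lra.
Qed.

Lemma paired_node_dist (u v : 'I_n * bool) :
  u != v -> 2 * h <= `|paired_node u - paired_node v|.
Proof.
have h0' := h0.
move=> uv; have [uv1|/paired_node_far] := eqVneq u.1 v.1; last first.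
  by have := separation_ge u.1; lra.
move: uv; rewrite -pair_eqE/= uv1 eqxx/= /paired_node uv1 opprD addrACA subrr add0r.
case: u.2; case: v.2 => //= _; rewrite ?opprK.
  by rewrite gtr0_norm ?addr_gt0//; lra.
by rewrite -opprD normrN gtr0_norm ?addr_gt0//; lra.
Qed.

Lemma paired_node_inj : injective paired_node.
Proof.
have h0' := h0.
move=> u v /eqP; rewrite -subr_eq0 => /eqP uv; apply/eqP.
have [//|/paired_node_dist] := boolP (u == v).
by rewrite uv normr0; lra.
Qed.

(** The factor of the partner [v] of [u] is at least 1/4. Each other factor is at least [1 - e];
    there are at most [2 n] of them, and by Bernoulli's inequality and [hs] their product is at
    least 1/2. *)
Lemma lagrange_near (u : 'I_n * bool) (x : R) :
  `|x - y u.1| <= h / 2 -> 8^-1 <= (lagrange_basis paired_node u).[x].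
Proof.
have h0' := h0; have hs' := hs.
move=> xy; rewrite horner_lagrange.
have s0 : 0 < s by have := separation_ge u.1; lra.
pose v := (u.1, ~~ u.2).
have vu : v != u by rewrite -pair_eqE/= negb_and orbC; case: u.2.
rewrite (bigD1 v)//=.
have f1 : 4^-1 <= (x - paired_node v) / (paired_node u - paired_node v).
  have -> : paired_node u - paired_node v = (if u.2 then 2 * h else - (2 * h)).
    by rewrite /paired_node /v/=; case: u.2 => /=; ring.
  move: xy; rewrite ler_norml /paired_node /v/= => /andP[xl xr].
  case: u.2 => /=.
    by rewrite ler_pdivlMr ?mulr_gt0//; lra.
  by rewrite invrN mulrN -mulNr ler_pdivlMr ?mulr_gt0//; lra.
(* [x] is within [3 * h / 2] of the node [u], and nodes of other pairs are at least [s / 2] away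
   from it; [e] is the quotient. *)
set e := 3 * h / s.
have e0 : 0 <= e <= 1.
  apply/andP; split; first by rewrite /e divr_ge0 ?mulr_ge0// ltW.
  by rewrite /e ler_pdivrMr// mul1r; have := separation_ge u.1; lra.
have f2 : (1 - e) ^+ #|[pred l | (l != u) && (l != v)]| <=
    \prod_(l | (l != u) && (l != v))
      ((x - paired_node l) / (paired_node u - paired_node l)).
  rewrite -prodr_const; apply: ler_prod => l /andP[lu lv].
  rewrite subr_ge0; apply/andP; split; first by case/andP: e0.
  have ul : u.1 != l.1.
    apply: contraNneq lv => ul; move: lu; rewrite /v -!pair_eqE/= ul eqxx/=.
    by case: l.2; case: u.2.
  have dn0 : paired_node u - paired_node l != 0.
    by rewrite -normr_gt0 (lt_le_trans _ (paired_node_far ul))//; lra.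
  have -> : (x - paired_node l) / (paired_node u - paired_node l) =
      1 + (x - paired_node u) / (paired_node u - paired_node l) by field.
  rewrite lerD2l lerNl; apply: le_trans (ler_norm _) _.
  rewrite normrN normrM normfV /e.
  have -> : 3 * h / s = (3 * h / 2) / (s / 2) by field; rewrite gt_eqF.
  apply: ler_pM => //.
    have := ler_normB (x - y u.1) (paired_node u - y u.1).
    by rewrite paired_nodeB opprB addrA subrK; lra.
  by rewrite lef_pV2 ?paired_node_far// ?qualifE/= ?normr_gt0//; lra.
have : 2^-1 <= (1 - e) ^+ #|[pred l | (l != u) && (l != v)]|.
  apply: le_trans (bernoulli_le _ e0).
  have : (#|[pred l | (l != u) && (l != v)]| <= n * 2)%N.
    by rewrite (leq_trans (max_card _))// card_prod card_ord card_bool.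
  set m := #|_|; rewrite -(ler_nat R) natrM => mn.
  suff : m%:R * e <= 2^-1 by lra.
  rewrite /e mulrA ler_pdivrMr//.
  have : m%:R * (3 * h) <= n%:R * 2 * (3 * h) by rewrite ler_pM2r//; lra.
  by lra.
move=> f3; have := le_trans f3 f2; set P := \prod_(_ | _) _ => f4.
have : 4^-1 * 2^-1 <= (x - paired_node v) / (paired_node u - paired_node v) * P.
  by apply: ler_pM => //; lra.
lra.
Qed.

(** The partner of [u] contributes a factor of order [1 / h], but both nodes of the pair of [j]
    contribute factors of order [h]; the net order is [h]. The remaining factors are bounded by a
    constant. *)
Lemma lagrange_far (u : 'I_n * bool) (j : 'I_n) (x : R) :
  j != u.1 -> `|x - y j| <= h / 2 ->
  `|(lagrange_basis paired_node u).[x]| <=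
    h * (9 * (A + 1) / s ^+ 2 * (4 * (A + 1) / s) ^+ (n * 2)).
Proof.
have h0' := h0; have h1' := h1.
move=> ju xy; rewrite horner_lagrange normr_prod.
have s0 : 0 < s by have := separation_ge u.1; lra.
have A0 : 0 <= A by apply: le_trans (yA j).
have sA : s <= 2 * A.
  have := ys ju; have := ler_normB (y j) (y u.1); have := yA j; have := yA u.1; lra.
pose v := (u.1, ~~ u.2).
have vu : v != u by rewrite -pair_eqE/= negb_and orbC; case: u.2.
have xB : `|x| <= A + 2^-1.
  have := ler_normD (x - y j) (y j); rewrite subrK; have := yA j; lra.
have xz l : `|x - paired_node l| <= 2 * (A + 1).
  have := ler_normB x (paired_node l); have := paired_node_le l; lra.
have num (l : 'I_n * bool) : l.1 = j -> `|x - paired_node l| <= 3 * h / 2.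
  move=> lj; have := ler_normB (x - y j) (paired_node l - y j).
  by rewrite -[in X in _ <= _ + X]lj paired_nodeB opprB addrA subrK; lra.
have ne (l : 'I_n * bool) : l.1 = j -> (l != u) && (l != v).
  move=> lj; rewrite -negb_or; apply/negP => /orP[]/eqP lE;
  by move: ju; rewrite -lj lE eqxx.
rewrite (bigD1 v)//= (bigD1 (j, true))/=; last exact: ne.
rewrite (bigD1 (j, false))/=; last by rewrite ne//= -pair_eqE/= andbF.
have fj b : `|(x - paired_node (j, b)) / (paired_node u - paired_node (j, b))| <=
    3 * h / s.
  rewrite normrM normfV.
  have -> : 3 * h / s = (3 * h / 2) / (s / 2) by field; rewrite gt_eqF.
  have d := @paired_node_far u (j, b).
  rewrite eq_sym in ju; have {}d := d ju.
  apply: ler_pM => //; first exact: num.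
  by rewrite lef_pV2// ?qualifE/=; lra.
have fv : `|(x - paired_node v) / (paired_node u - paired_node v)| <=
    2 * (A + 1) / (2 * h).
  rewrite normrM normfV; apply: ler_pM => //.
  have := paired_node_dist vu; rewrite distrC => d.
  by rewrite lef_pV2// ?qualifE/=; lra.
have s2 : 0 < s / 2 by lra.
set P := (X in _ * (_ * (_ * X))).
set D := 4 * (A + 1) / s.
(* Since [1 <= D], the number of remaining factors may be rounded up to [n * 2]. *)
have D1 : 1 <= D by rewrite /D ler_pdivlMr//; lra.
have PD : 0 <= P <= D ^+ (n * 2).
  apply/andP; split; first by apply: prodr_ge0 => l _.
  apply: (@le_trans _ _ (D ^+ #|[pred l |
    (((l != u) && (l != v)) && (l != (j, true))) && (l != (j, false))]|)).
    rewrite -prodr_const; apply: ler_prod => l /andP[/andP[/andP[lu lv] _] _].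
    rewrite normr_ge0/= normrM normfV.
    have ul : u.1 != l.1.
      apply: contraNneq lv => ul; move: lu; rewrite /v -!pair_eqE/= ul eqxx/=.
      by case: l.2; case: u.2.
    have -> : D = 2 * (A + 1) / (s / 2) by rewrite /D; field; rewrite gt_eqF.
    apply: ler_pM => //.
    by rewrite lef_pV2 ?paired_node_far// qualifE/= (lt_le_trans s2)// paired_node_far.
  apply: ler_weXn2l => //.
  by rewrite (leq_trans (max_card _))// card_prod card_ord card_bool.
have [P0 PD'] := andP PD.
apply: (@le_trans _ _ (2 * (A + 1) / (2 * h) * (3 * h / s * (3 * h / s * D ^+ (n * 2))))).
  apply: ler_pM => //; first by rewrite !mulr_ge0.
  apply: ler_pM => //; first by rewrite !mulr_ge0.
  by apply: ler_pM.
rewrite le_eqVlt; apply/orP; left; apply/eqP; field.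
by rewrite !gt_eqF.
Qed.

End paired_nodes.

(** * Realizing small perturbations of the moments *)

Section moment_perturbation.
Context {R : realType}.

Lemma integrable_horner (mu : probability R R) (D : set R) (B : R) (q : {poly R}) :
  measurable D -> (forall x, D x -> `|x| <= B) ->
  mu.-integrable D (fun x => (q.[x])%:E).
Proof.
move=> mD DB.
have intX (m : nat) : mu.-integrable D (EFin \o (fun x => q`_m * x ^+ m)).
  apply: (integrableZl mD _ (f := EFin \o (fun x => x ^+ m))).
  apply: measurable_bounded_integrable => //.
    by rewrite (le_lt_trans (probability_le1 mu mD))// ltry.
  exists (`|B| ^+ m); split; first exact: num_real.
  move=> M BM x Dx; rewrite /= normrX (le_trans _ (ltW BM))//.
  by rewrite lerXn2r ?nnegrE// (le_trans (DB x Dx))// ler_norm.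
have [int _] := Rintegral_sum (index_enum 'I_(size q)) mD (fun i => intX (nat_of_ord i)).
rewrite (_ : (fun x => _) = EFin \o (fun x => \sum_(i < size q) q`_i * x ^+ i))//.
by apply/funext => x /=; rewrite horner_coef.
Qed.

(** The length [h] is fixed before the mass [kap]: in the application the mass available in an
    interval of length [h] depends on [h]. Neither [h] nor [eps] depends on [mu]. *)
Lemma moment_perturbation (n p : nat) (A s : R) :
  (0 < n)%N -> (p < n * 2)%N -> 0 < A -> 0 < s ->
  exists2 h : R, 0 < h & forall kap : R, 0 < kap ->
  exists2 eps : R, 0 < eps &
  forall (mu : probability R R) (y : 'I_n -> R) (delta : nat -> R),
    finite_moments p mu ->
    (forall i, `|y i| <= A) -> (forall i j, i != j -> s <= `|y i - y j|) ->
    (forall i, (kap%:E <= mu `[y i, (y i + h)%R]%classic)%E) ->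
    delta 0%N = 0 -> (forall j, (j <= p)%N -> `|delta j| <= eps) ->
    exists nu : probability R R, [/\
      coincide_on [set x : R | A + 1 < `|x|] nu mu,
      finite_moments p nu &
      forall j, (j <= p)%N -> moment nu j = moment mu j + delta j].
Proof.
move=> n0 pn A0 s0.
have nR0 : (0 : R) < n%:R by rewrite ltr0n.
have [C0 C00 C0E] : exists2 C0, 0 < C0 &
    C0 = 9 * (A + 1) / s ^+ 2 * (4 * (A + 1) / s) ^+ (n * 2).
  eexists; last reflexivity.
  by rewrite mulr_gt0 ?exprn_gt0 ?divr_gt0 ?mulr_gt0 ?exprn_gt0 ?addr_gt0.
(* The three bounds keep the nodes within [A + 1 / 2], meet the separation [hs], and limit the total
   far contribution to [kp / 16]. *)
pose h := Num.min 2^-1 (Num.min (s / (12 * n%:R)) (16 * n%:R * C0)^-1).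
have h0 : 0 < h.
  rewrite /h !lt_min; apply/and3P; split; first by rewrite invr_gt0.
    by rewrite divr_gt0 ?mulr_gt0.
  by rewrite invr_gt0 !mulr_gt0.
have h1 : h <= 2^-1 by rewrite /h ge_min lexx.
have hs : 12 * n%:R * h <= s.
  by rewrite mulrC -ler_pdivlMr ?mulr_gt0// /h !ge_min lexx/= orbT.
have hC : n%:R * (h * C0) <= 16^-1.
  have : h <= (16 * n%:R * C0)^-1 by rewrite /h !ge_min lexx !orbT.
  rewrite -(ler_pM2r (_ : 0 < n%:R * C0)) ?mulr_gt0//.
  have -> : (16 * n%:R * C0)^-1 * (n%:R * C0) = 16^-1.
    by field; rewrite !gt_eqF.
  by rewrite mulrCA.
(* The Lagrange estimates hold within half of the node offset [h], so the intervals have length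
   [h / 2]. *)
exists (h / 2); first by rewrite divr_gt0.
move=> kap kap0.
have [D D0 DE] : exists2 D, 0 < D &
    D = ((1 + (A + 2^-1)) / (2 * h)) ^+ #|{: 'I_n * bool}|.-1.
  eexists; last reflexivity.
  by rewrite exprn_gt0// divr_gt0 ?mulr_gt0// !addr_gt0.
(* Every [J i] loses exactly the mass [kp]; dividing by [n] ensures that the fraction [a i] is at
   most [n^-1]. *)
pose kp := kap / n%:R.
have kp0 : 0 < kp by rewrite divr_gt0.
(* [D] bounds the coefficients of the basis, so [p.+1] terms [D * eps] add up to [kp / 16]. *)
pose eps := kp / (16 * p.+1%:R * D).
have eps0 : 0 < eps by rewrite divr_gt0// !mulr_gt0.
exists eps => // mu y delta intmu yA ys muJ d0 deps.
pose J (i : 'I_n) : set R := `[y i, (y i + h / 2)%R]%classic.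
have mJ i : measurable (J i) by exact: measurable_itv.
have Jnear i x : J i x -> `|x - y i| <= h / 2.
  by rewrite /J/= in_itv/= => /andP[? ?]; rewrite ger0_norm; lra.
have JA i x : J i x -> `|x| <= A + 2^-1.
  move=> /Jnear xy; have := ler_normD (x - y i) (y i); have := yA i.
  rewrite subrK => yi xx; apply: (le_trans xx); lra.
have finJ i : mu (J i) \is a fin_num.
  by rewrite ge0_fin_numE// (le_lt_trans (probability_le1 mu (mJ i)))// ltry.
have Jkap i : kap <= fine (mu (J i)) by rewrite -lee_fin fineK//; exact: muJ.
have J0 i : 0 < fine (mu (J i)) by apply: lt_le_trans (Jkap i).
pose a i := kp / fine (mu (J i)).
have a0 i : 0 < a i by rewrite divr_gt0.
have aJ i : a i * fine (mu (J i)) = kp by rewrite divfK// gt_eqF.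
pose z := paired_node y h.
have intL i k : mu.-integrable (J i) (fun x => ((lagrange_basis z k).[x])%:E).
  exact: integrable_horner (mJ i) (JA i).
have low (i : 'I_n) (k : 'I_n * bool) (c : R) :
    (forall x, J i x -> c <= (lagrange_basis z k).[x]) ->
    kp * c <= a i * \int[mu]_(x in J i) (lagrange_basis z k).[x].
  move=> cL; rewrite -(aJ i) -mulrA ler_pM2l// mulrC -Rintegral_cst//.
  apply: le_Rintegral => //; last exact: intL.
  apply: measurable_bounded_integrable => //.
    by rewrite -ge0_fin_numE//; exact: finJ.
  exists `|c|; split; first exact: num_real.
  by move=> M cM x _; exact: ltW.
have [nu [nuS nuI nuM]] : exists nu : probability R R, [/\
    forall S, measurable S -> (forall i, S `&` J i = set0) ->
      (forall k, ~ S (z k)) -> nu S = mu S,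
    finite_moments p nu &
    forall j, (j <= p)%N -> moment nu j = moment mu j + delta j].
  apply: (@moment_surgery _ mu n p J a _ z (lagrange_basis z) delta) => //.
  - move=> i; rewrite ltW//= /a ler_pdivrMr// /kp [leRHS]mulrC ler_pM2r ?invr_gt0//.
  - move=> j jp; apply: lagrange_interpolation; first exact: paired_node_inj ys h0 hs.
    by rewrite card_prod card_ord card_bool (leq_ltn_trans jp).
  - move=> k.
    have near : kp / 8 <= a k.1 * \int[mu]_(x in J k.1) (lagrange_basis z k).[x].
      apply: low => x /Jnear xk; exact: lagrange_near ys h0 hs _ _ xk.
    have far i : i != k.1 -> kp * - (h * C0) <=
        a i * \int[mu]_(x in J i) (lagrange_basis z k).[x].
      move=> ik; apply: low => x /Jnear xi.
      rewrite lerNl (le_trans (ler_norm _))// normrN.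
      rewrite C0E; by apply: (lagrange_far yA ys h0 h1 hs); [exact: ik|exact: xi].
    (* The interval of [k] gives at least [kp / 8], and the fewer than [n] others take away at most
       [kp / 16] in all. *)
    have sum1 : kp / 16 <= \sum_(i < n) a i * \int[mu]_(x in J i) (lagrange_basis z k).[x].
      rewrite (bigD1 k.1)//=.
      have : \sum_(i < n | i != k.1) kp * - (h * C0) <=
          \sum_(i < n | i != k.1) a i * \int[mu]_(x in J i) (lagrange_basis z k).[x].
        exact: ler_sum.
      have : kp * - (h * C0) *+ n <= \sum_(i < n | i != k.1) kp * - (h * C0).
        rewrite sumr_const; apply: ler_wnMn2l.
          by rewrite mulrN oppr_le0 !mulr_ge0// ltW.
        by rewrite (leq_trans (max_card _))// card_ord.
      have : kp * (n%:R * (h * C0)) <= kp / 16 by rewrite ler_pM2l.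
      by rewrite -[_ *+ n]mulr_natr; lra.
    have sum2 : - (kp / 16) <= \sum_(m < p.+1) (lagrange_basis z k)`_m * delta m.
      rewrite lerNl (le_trans (ler_norm _))// normrN.
      apply: (le_trans (ler_norm_sum _ _ _)).
      have -> : kp / 16 = \sum_(m < p.+1) D * eps.
        rewrite sumr_const card_ord -[RHS]mulr_natr /eps; field.
        by rewrite !gt_eqF// addrC.
      apply: ler_sum => m _; rewrite normrM; apply: ler_pM => //.
        rewrite DE; apply: coef_lagrange_le => //; first by rewrite mulr_gt0.
          by move=> l; exact: paired_node_le yA h0 h1 _.
        move=> l lk; apply: (paired_node_dist ys h0 hs).
        by rewrite eq_sym.
      by apply: deps; rewrite -ltnS.
    lra.
(* All intervals and nodes lie in [|x| <= A + 1 / 2]. *)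
exists nu; split=> // S mS SA; apply: nuS => // [i|k].
- apply/seteqP; split=> // x [/SA/= Ax /JA xA]; lra.
- by move=> /SA/= Ak; have := paired_node_le yA h0 h1 k; rewrite -/(z k) => zk; lra.
Qed.

End moment_perturbation.

(** * Inverting the flow on moments *)

Section moment_deconvolution.
Context {R : realType}.

(* The moments of [X_t] are triangular in those of [X], with diagonal [e^{-jt/2}]. *)
Lemma ou_moment_system (M g : nat -> R) (p : nat) : g 0%N = 1 ->
  exists N : nat -> R -> R, forall j, (j <= p)%N ->
    [/\ {for 0, continuous (N j)}, N j 0 = M j &
      forall t, \sum_(i < j.+1) ((Num.sqrt (1 - expR (- t)) : R) ^+ i * g i) *
        (expR (- t / 2) ^+ (j - i) * N (j - i)%N t) *+ 'C(j, i) = M j].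
Proof.
move=> g0.
have ca : {for (0 : R), continuous (fun t : R => expR (- t / 2))}.
  apply: continuous_comp; last exact: continuous_expR.
  by apply: cvgMl; exact: cvgN.
(* [Num.sqrt] vanishes on negative numbers, so continuity at 0 holds from both sides. *)
have cb : {for (0 : R), continuous (fun t : R => Num.sqrt (1 - expR (- t)))}.
  apply: continuous_comp; last exact: sqrt_continuous.
  apply: cvgB; first exact: cvg_cst.
  by apply: continuous_comp; [exact: cvgN|exact: continuous_expR].
elim: p => [|p [N IH]].
  exists (fun=> cst (M 0%N)) => j; rewrite leqn0 => /eqP ->; split=> [| |t] //.
    exact: cvg_cst.
  by rewrite big_ord_recl big_ord0 addr0 !expr0 g0 !mul1r bin0.
(* The terms of order [p.+1] with at least one Gaussian factor, hence the shift [i.+1]. They involve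
   lower moments only, and vanish at [t = 0]. *)
pose rest t := \sum_(i < p.+1) (Num.sqrt (1 - expR (- t)) ^+ i.+1 * g i.+1) *
  (expR (- t / 2) ^+ (p - i) * N (p - i)%N t) *+ 'C(p.+1, i.+1).
have rest0 : rest 0 = 0.
  rewrite /rest big1// => i _.
  by rewrite oppr0 expR0 subrr sqrtr0 expr0n/= !mul0r mul0rn.
have crest : {for 0, continuous rest}.
  apply: cvg_big => [|i _]; first exact: add_continuous.
  apply: cvgMn; apply: cvgM.
    apply: cvgM; last exact: cvg_cst.
    by apply: (cvg_comp _ (fun x => x ^+ i.+1) cb); exact: exprn_continuous.
  apply: cvgM; last by have [] := IH (p - i)%N (leq_subr _ _).
  by apply: (cvg_comp _ (fun x => x ^+ (p - i)) ca); exact: exprn_continuous.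
(* The equation of order [p.+1] is solved by dividing by its nonzero diagonal coefficient; lower
   orders are kept. *)
exists (fun j t => if j == p.+1 then (M j - rest t) / expR (- t / 2) ^+ j else N j t) => j.
rewrite leq_eqVlt => /orP[/eqP ->|]; last first.
  rewrite ltnS => jp; have [cN N0 Nsys] := IH j jp.
  have ne i : (j - i == p.+1)%N = false.
    by apply/negbTE; rewrite neq_ltn ltnS (leq_trans (leq_subr _ _)).
  have := ne 0%N; rewrite subn0 => ->; split=> // t.
  by under eq_bigr do rewrite ne; exact: Nsys.
rewrite eqxx; split=> [| |t].
- apply: cvgM; first by apply: cvgB => //; exact: cvg_cst.
  apply: cvgV; first by rewrite expf_neq0// gt_eqF// expR_gt0.
  by apply: (cvg_comp _ (fun x => x ^+ p.+1) ca); exact: exprn_continuous.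
- by rewrite rest0 subr0 oppr0 mul0r expR0 expr1n divr1.
rewrite big_ord_recl expr0 g0 !mul1r subn0 eqxx bin0 mulr1n.
rewrite mulrC divfK ?expf_neq0// ?gt_eqF ?expR_gt0//.
rewrite -[RHS](subrK (rest t)); congr (_ + _); apply: eq_bigr => i _.
rewrite lift0 subSS ifF//; apply/negbTE.
by rewrite neq_ltn ltnS leq_subr.
Qed.

(** Continuity at 0 of finitely many prescribed moments gives one [t0] for all orders. It is
    determined by [M], [g], [p] and [eps], before any measure is given. *)
Lemma ou_moment_perturbation (M g : nat -> R) (p : nat) (eps : R) :
  g 0%N = 1 -> 0 < eps ->
  exists2 t0 : R, 0 < t0 & forall t, 0 <= t <= t0 ->
  exists2 delta : nat -> R,
    delta 0%N = 0 /\ (forall j, (j <= p)%N -> `|delta j| <= eps) &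
    forall j, (j <= p)%N ->
      \sum_(i < j.+1) ((Num.sqrt (1 - expR (- t)) : R) ^+ i * g i) *
        (expR (- t / 2) ^+ (j - i) * (M (j - i)%N + delta (j - i)%N)) *+ 'C(j, i)
      = M j.
Proof.
move=> g0 eps0; have [N NM] := ou_moment_system M p g0.
have : \forall t \near (0 : R), forall j : 'I_p.+1, `|M j - N j t| < eps.
  near=> t; near: t; apply: filter_forall => j.
  have [cN N0 _] := NM j (ltn_ord j).
  by have /cvgrPdist_lt/(_ _ eps0) := cN; rewrite N0.
(* The ball is open while [t <= t0] is not strict, hence the half. *)
move=> /nbhs_ballP[e /= e0 eN]; exists (e / 2); first by rewrite divr_gt0.
move=> t /andP[t0 te]; have {}eN : forall j : 'I_p.+1, `|M j - N j t| < eps.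
  by apply: eN; rewrite /ball/= sub0r normrN ger0_norm//; lra.
exists (fun j => N j t - M j); first split.
- have [_ _ /(_ t)] := NM 0%N (leq0n _).
  by rewrite big_ord_recl big_ord0 addr0 !expr0 g0 !mul1r bin0 mulr1n => ->; rewrite subrr.
- by move=> j jp; rewrite distrC ltW// (eN (Ordinal (jp : (j < p.+1)%N))).
- move=> j jp; have [_ _ Nsys] := NM j jp; rewrite -[RHS](Nsys t).
  by apply: eq_bigr => i _; rewrite addrCA subrr addr0.
Unshelve. all: by end_near. Qed.

End moment_deconvolution.

(** * Separated short intervals of positive mass *)

Section support_points.
Context {R : realType}.

(** Pigeonhole: [N.+1] pieces of length [l / N.+1] cover the interval, and by subadditivity they
    cannot all have mass at most [kappa / N.+1]. *)
Lemma small_interval (mu : probability R R) (x l kappa h : R) (N : nat) :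
  0 < l -> l <= N.+1%:R * h -> (kappa%:E < mu `[x, (x + l)%R]%classic)%E ->
  exists2 y, x <= y <= x + l &
    ((kappa / N.+1%:R)%:E <= mu `[y, (y + h)%R]%classic)%E.
Proof.
move=> l0 lh; apply: contraPP => nex.
have N0 : (0 : R) < N.+1%:R by [].
pose d := l / N.+1%:R; have d0 : 0 < d by rewrite divr_gt0.
have dh : d <= h by rewrite ler_pdivrMr// mulrC.
have small y : x <= y <= x + l ->
    (mu `[y, (y + d)%R]%classic <= (kappa / N.+1%:R)%:E)%E.
  move=> xy; apply: contra_notT nex; rewrite -ltNge => lt; exists y => //.
  apply: (le_trans (ltW lt)); apply: le_measure; rewrite ?inE//.
  by apply: subset_itvl; rewrite bnd_simp lerD2l.
have step m : (m <= N)%N ->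
    (mu `[x, (x + m.+1%:R * d)%R]%classic <= (m.+1%:R * (kappa / N.+1%:R))%:E)%E.
  elim: m => [_|m IH mN]; first by rewrite !mul1r; apply: small; lra.
  have mN' : m.+1%:R * d <= l.
    by rewrite /d mulrA ler_pdivrMr// [leRHS]mulrC ler_pM2r// ler_nat ltnS ltnW.
  have md0 : 0 <= m.+1%:R * d by rewrite mulr_ge0// ltW.
  apply: (@le_trans _ _ (mu (`[x, (x + m.+1%:R * d)%R]%classic `|`
      `[(x + m.+1%:R * d)%R, (x + m.+1%:R * d + d)%R]%classic))).
    apply: le_measure; rewrite ?inE//; first exact: measurableU.
    move=> w; rewrite /= !in_itv/= => /andP[xw wm].
    have [?|/ltW ?] := leP w (x + m.+1%:R * d); [left|right]; apply/andP; split=> //.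
    by apply: (le_trans wm); rewrite -addrA lerD2l -[m.+2%:R]natr1; lra.
  apply: le_trans (measureU2 _ _ _) _ => //.
  rewrite -[m.+2%:R]natr1 mulrDl mul1r EFinD leeD//; first by rewrite IH// ltnW.
  by apply: small; lra.
apply/negP; rewrite -leNgt.
have := step N (leqnn N).
have -> : N.+1%:R * d = l by rewrite mulrC divfK// gt_eqF.
by have -> : N.+1%:R * (kappa / N.+1%:R) = kappa by rewrite mulrC divfK// gt_eqF.
Qed.

(* The interval attached to the largest [x_i] may leave [[-A, A]]; it is dropped. *)
Lemma p_support_separated (mu : probability R R) (n N : nat) (c c' kappa A h : R) :
  c' <= N.+1%:R * h -> p_support n.+1 c c' kappa A mu ->
  exists y : 'I_n -> R, [/\ forall i, `|y i| <= A,
    forall i j, i != j -> c - c' <= `|y i - y j| &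
    forall i, ((kappa / N.+1%:R)%:E <= mu `[y i, (y i + h)%R]%classic)%E].
Proof.
move=> ch [/andP[c'0 c'c] kap0 A0 [x [xc xk xA]]].
pose i0 := [arg max_(i > ord0) x i]%O.
have xmax i : x i <= x i0 by rewrite /i0; case: arg_maxP => // j _; exact.
have /choice[y yP] : forall i, exists y, x (lift i0 i) <= y <= x (lift i0 i) + c' /\
    ((kappa / N.+1%:R)%:E <= mu `[y, (y + h)%R]%classic)%E.
  by move=> i; have [y ? ?] := small_interval c'0 ch (xk (lift i0 i)); exists y.
exists y; split=> [i|i j ij|i]; last by have [] := yP i.
(* The largest point exceeds this one by more than [c > c'], so the interval ends before it, hence
   before [A]. *)
- have [/andP[y1 y2] _] := yP i.
  have := xc i0 (lift i0 i) (neq_lift _ _).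
  have := xA i0; have := xA (lift i0 i); have := xmax (lift i0 i).
  rewrite !ler_norml => m1 /andP[l1 _] /andP[_ l2].
  rewrite ger0_norm ?subr_ge0// => l3; apply/andP; split; lra.
(* Both points move to the right by at most [c'], so their difference changes by at most [c']. *)
- have [/andP[yi1 yi2] _] := yP i; have [/andP[yj1 yj2] _] := yP j.
  have := xc (lift i0 i) (lift i0 j); rewrite (inj_eq lift_inj) => /(_ ij).
  rewrite ltr_normr ler_normr => /orP[] ?; apply/orP; [left|right]; lra.
Qed.

End support_points.

(** * Invariance of the normalized first two moments *)

Section two_moments.
Context {R : realType}.

Lemma ou_two_moments (mu : probability R R) (t : R) d (T : measurableType d)
    (P : probability T R) (X G : {RV P >-> R}) :
  moment mu 1 = 0 -> moment mu 2 = 1 -> finite_moments 2 mu -> 0 <= t ->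
  independent_RV X G -> has_distribution X mu ->
  has_distribution G (normal_prob 0 1) ->
  finite_moments 2 (distribution P (ou_flow t X G)) /\
  forall j, (1 <= j <= 2)%N ->
    moment (distribution P (ou_flow t X G)) j = moment mu j.
Proof.
move=> m1 m2 intmu t0 indep lawX lawG.
have [int ouM] := moment_ou_flow t indep lawX lawG intmu; split=> // j.
(* Here [0 <= t] enters: it makes the radicand nonnegative. The squared coefficients of [X] and [G]
   then add up to 1. *)
have b2 : Num.sqrt (1 - expR (- t)) ^+ 2 = 1 - expR (- t).
  by rewrite sqr_sqrtr// subr_ge0 expR_le1 oppr_le0.
have a2 : expR (- t / 2) ^+ 2 = expR (- t).
  by rewrite -expRM_natl; congr expR; field.
have g1 := @Rintegral_normal1 R; have g2 := @Rintegral_normal2 R.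
have g0 := @Rintegral_normal0 R.
have m0 := moment0 mu.
move: (Num.sqrt _ : R) b2 ouM => b b2 ouM.
case: j => [|[|[|j]]]// _; rewrite ouM// !big_ord_recl big_ord0/= /bump/=;
  rewrite !addn0 !subn0.
  by rewrite g1 m1 !mulr0 mul0r !mul0rn !addr0.
rewrite -[(1 + 1)%N]/2%N -[(2 - 1)%N]/1%N subnn.
by rewrite g0 g1 g2 m0 m1 m2 b2 a2 bin0 binn !mulr0 mul0rn; ring.
Qed.

End two_moments.

Theorem lemma2p5 (R : realType) (p : nat) (hp : (2 <= p)%N)
    (c c' kappa A : R) (m : 'rV[R]_p) :
  exists t0 : R, 0 < t0 /\
    forall mu : probability R R,
      finite_moments p mu -> moments p mu = m ->
      p_support p c c' kappa A mu ->
      moment mu 1 = 0 -> moment mu 2 = 1 ->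
      forall t : R, 0 <= t <= t0 ->
      exists nu : probability R R,
        coincide_on [set x : R | A + 1 < `|x|] nu mu /\
        forall (d : measure_display) (T : measurableType d)
          (P : probability T R) (X G : {RV P >-> R}),
          independent_RV X G ->
          has_distribution X nu ->
          has_distribution G (normal_prob 0 1) ->
          finite_moments p (distribution P (ou_flow t X G)) /\
          forall j : nat, (1 <= j <= p)%N ->
            moment (distribution P (ou_flow t X G)) j = moment mu j.
Proof.
have [p2|p2] := eqVneq p 2%N.
  subst p; exists 1; split=> // mu intmu _ _ m1 m2 t /andP[t0 _].
  exists mu; split=> // d T P X G indep lawX lawG.
  exact: (ou_two_moments m1 m2 intmu t0 indep lawX lawG).
(* For parameters violating these inequalities no measure has [p]-support, and any [t0] will do. *)
have [/andP[/andP[c'0 c'c] /andP[kap0 A0]]|bad] :=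
    boolP ((0 < c' < c) && ((0 < kappa) && (0 < A))); last first.
  exists 1; split=> // mu _ _ [cc kap0 A0 _].
  by move: bad; rewrite cc kap0 A0.
case: p hp m p2 => [//|n] hn m n2.
have s0 : 0 < c - c' by rewrite subr_gt0.
(* From here on the order is [n.+1]; with [n] intervals the requirement [n.+1 < n * 2] is the case
   of at least three moments. *)
have [||h h0 pert] := @moment_perturbation R n n.+1 A (c - c') _ _ A0 s0.
- by move: hn.
- by move: hn n2; lia.
(* Number of pieces that makes those of an interval of length [c'] no longer than [h]. *)
pose N := Num.bound (c' / h).
have Nh : c' <= N.+1%:R * h.
  rewrite -ler_pdivrMr// (le_trans (ler_norm _))// ltW//.
  rewrite (lt_le_trans (archi_boundP _))//.
  by rewrite ler_nat /N ger0_norm ?divr_ge0// ltW.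
have [eps eps0 {}pert] := pert (kappa / N.+1%:R) (divr_gt0 kap0 (ltr0Sn _ _)).
(* The moments are read off [m], with order 0 set to 1, so that [t0] is chosen before [mu]. Orders
   beyond the length of [m] get the default 0. *)
pose M (j : nat) : R := if j is k.+1 then odflt 0 (omap (m 0) (insub k)) else 1.
have [t0 t00 tM] := @ou_moment_perturbation R M
  (fun i => \int[normal_prob 0 1]_y (y ^+ i)) n.+1 eps (@Rintegral_normal0 R) eps0.
exists t0; split=> // mu intmu mum supp _ _ t tt0.
have ME j : (j <= n.+1)%N -> M j = moment mu j.
  case: j => [|j] jn; first by rewrite moment0.
  by rewrite /M insubT//= -mum mxE.
have [y [yA ys ykap]] := p_support_separated Nh supp.
have [delta [d0 deps] sys] := tM t tt0.
have [nu [nuS intnu nuM]] := pert mu y delta intmu yA ys ykap d0 deps.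
exists nu; split=> // d T P X G indep lawX lawG.
have [int ouM] := moment_ou_flow t indep lawX lawG intnu.
split=> // j /andP[_ jp]; rewrite ouM// -ME// -[RHS]sys//.
apply: eq_bigr => i _; rewrite nuM ?ME//; exact: leq_trans (leq_subr _ _) jp.
Qed.
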